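(* Let $G$ be an elementary abelian $3$-group of order $243$. Then there exists a signed difference set in $G$ with parameters $(243,242,161)$.
   Context: For a finite group $G$ of order $v$, with identity written $0_G$, a subset $S\subseteq G$ is identified with $\sum_{s\in S}s$ in the group ring $\mathbb{Z}[G]$. Let $D=\sum_{i=1}^k s_id_i\in\mathbb{Z}[G]$ with distinct $d_i\in G$ and $s_i\in\{-1,1\}$, and put $D^{-1}=\sum_i s_id_i^{-1}$. $D$ is a $(v,k,\lambda)$-signed difference set in $G$ if $DD^{-1}=\lambda G+(k-\lambda)\cdot 0_G$, where $\lambda$ is an integer. *)

(* Defs.v *)
From HB Require Import structures.
From mathcomp Require Import all_boot all_order all_algebra.
From mathcomp Require Import all_fingroup all_solvable.

Set Implicit Arguments.
Unset Strict Implicit.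
Unset Printing Implicit Defensive.

Import GRing.Theory.
Local Open Scope ring_scope.

(* The integral group ring Z[gT]: an element is its family of coefficients,
   and the product is convolution. The alias keeps it apart from {ffun gT -> int},
   on which the library's product is pointwise. *)
Definition group_ring (gT : finGroupType) := {ffun gT -> int}.
HB.instance Definition _ (gT : finGroupType) :=
  GRing.Zmodule.copy (group_ring gT) {ffun gT -> int}.

Definition gr_elt (gT : finGroupType) (g : gT) : group_ring gT :=
  [ffun x => (x == g)%:Z].

Definition gr_mul (gT : finGroupType) (a b : group_ring gT) : group_ring gT :=
  [ffun g => \sum_(h : gT) a h * b (h^-1 * g)%g].

Section GroupRing.
Variable gT : finGroupType.
Implicit Types a b c : group_ring gT.

Fact gr_mulA : associative (@gr_mul gT).
Proof.
move=> a b c; apply/ffunP => g; rewrite !ffunE.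
under eq_bigr => h _ do rewrite ffunE mulr_sumr.
under [RHS]eq_bigr => h _ do rewrite ffunE mulr_suml.
rewrite [RHS]exchange_big; apply: eq_bigr => h _ /=.
rewrite [RHS](reindex_inj (mulgI h)) /=; apply: eq_bigr => x _.
by rewrite mulrA mulKg invMg mulgA.
Qed.

Fact gr_mul1r : left_id (gr_elt 1%g) (@gr_mul gT).
Proof.
move=> a; apply/ffunP => g; rewrite ffunE (bigD1 1%g) //= big1 => [|h ne1].
  by rewrite addr0 ffunE eqxx mul1r invg1 mul1g.
by rewrite ffunE (negPf ne1) mul0r.
Qed.

Fact gr_mulr1 : right_id (gr_elt 1%g) (@gr_mul gT).
Proof.
move=> a; apply/ffunP => g; rewrite ffunE (bigD1 g) //= big1 => [|h neg].
  by rewrite addr0 ffunE mulVg eqxx mulr1.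
by rewrite ffunE -eq_mulVg1 (negPf neg) mulr0.
Qed.

Fact gr_mulDl : left_distributive (@gr_mul gT) +%R.
Proof.
move=> a b c; apply/ffunP => g; rewrite !ffunE -big_split /=.
by apply: eq_bigr => h _; rewrite ffunE mulrDl.
Qed.

Fact gr_mulDr : right_distributive (@gr_mul gT) +%R.
Proof.
move=> a b c; apply/ffunP => g; rewrite !ffunE -big_split /=.
by apply: eq_bigr => h _; rewrite ffunE mulrDr.
Qed.

Fact gr_oner_neq0 : gr_elt 1%g != 0 :> group_ring gT.
Proof. by apply/eqP => /ffunP/(_ 1%g); rewrite !ffunE eqxx. Qed.

HB.instance Definition _ := GRing.Zmodule_isNzRing.Build (group_ring gT)
  gr_mulA gr_mul1r gr_mulr1 gr_mulDl gr_mulDr gr_oner_neq0.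

End GroupRing.

Definition gr_set (gT : finGroupType) (A : {set gT}) : group_ring gT :=
  \sum_(g in A) gr_elt g.

Definition signed_sum (gT : finGroupType) (k : nat)
    (s : 'I_k -> int) (d : 'I_k -> gT) : group_ring gT :=
  \sum_(i < k) gr_elt (d i) *~ s i.

(* For a subgroup G of gT, Z[G] is regarded as the subring of Z[gT] supported
   on G. The identity 0_G of G is 1%g. *)
Definition signed_difference_set (gT : finGroupType) (G : {group gT})
    (v k : nat) (lambda : int) (D : group_ring gT) : Prop :=
  #|G| = v /\
  exists (s : 'I_k -> int) (d : 'I_k -> gT),
    [/\ forall i, d i \in G,
        injective d,
        forall i, s i = -1 \/ s i = 1,
        D = signed_sum s d
      & D * signed_sum s (fun i => (d i)^-1%g) =
          gr_set G *~ lambda + gr_elt 1%g *~ (k%:Z - lambda)].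

(* Main.v *)
From mathcomp Require Import ring.
From mathcomp Require mxabelem.
Require Import Defs.
From mathcomp Require Import all_boot all_order all_algebra.
From mathcomp Require Import all_fingroup all_solvable.

(* The 11 columns of a parity-check matrix of the perfect ternary Golay code
   and their negatives form a set S of 22 vectors in F_3^5.  As the code is
   perfect with minimum distance 5, every vector outside S and 0 is the sum of
   a unique unordered pair of elements of S; hence in the group ring
   S^2 = 22 + S + 2N, where N = G - 1 - S.  The signed difference set is
   D = N - S = G - (1 + 2S): it is fixed by inversion, and
   D^2 = (243 - 2 * 45) G + (1 + 2S)^2 = 153 G + (81 + 8G) = 161 G + 81. *)

Set Implicit Arguments.
Unset Strict Implicit.
Unset Printing Implicit Defensive.

Import GRing.Theory.
Local Open Scope ring_scope.

(** * Sums of group elements in the group ring *)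

Section GroupRingSums.
Variable gT : finGroupType.
Implicit Types (g h : gT) (G : {group gT}).

Lemma gr_mulrnE (a : group_ring gT) n x : (a *+ n) x = a x *+ n.
Proof. by elim: n => [|n IHn]; rewrite ?mulr0n ?mulrS ffunE ?IHn. Qed.

Lemma gr_mulrzE (a : group_ring gT) z x : (a *~ z) x = a x *~ z.
Proof.
by case: z => n; rewrite ?NegzE ?mulrNz -!pmulrn ?ffunE gr_mulrnE.
Qed.

Lemma gr_eltM g h : gr_elt g * gr_elt h = gr_elt (g * h)%g.
Proof.
apply/ffunP => x; rewrite !ffunE (bigD1 g) //= big1 => [|y neg].
  by rewrite !ffunE eqxx mul1r addr0 -(inj_eq (mulgI g) _ h) mulKVg.
by rewrite ffunE (negPf neg) mul0r.
Qed.

Lemma gr_set_mulr G g : g \in G -> gr_set G * gr_elt g = gr_set G.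
Proof.
move=> Gg; rewrite /gr_set mulr_suml [RHS](reindex_inj (mulIg g)) /=.
by apply: eq_big => [x | x _]; rewrite ?groupMr ?gr_eltM.
Qed.

Lemma gr_set_mull G g : g \in G -> gr_elt g * gr_set G = gr_set G.
Proof.
move=> Gg; rewrite /gr_set mulr_sumr [RHS](reindex_inj (mulgI g)) /=.
by apply: eq_big => [x | x _]; rewrite ?groupMl ?gr_eltM.
Qed.

Definition gr_seq (s : seq gT) : group_ring gT := \sum_(g <- s) gr_elt g.

Lemma gr_set_seq G s : perm_eq s (enum G) -> gr_set G = gr_seq s.
Proof. by move=> eq_s; rewrite /gr_seq (perm_big _ eq_s) big_enum. Qed.

Lemma gr_set_mul_seq G s :
  {subset s <= G} -> gr_set G * gr_seq s = gr_set G *+ size s.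
Proof.
move=> sG; rewrite mulr_sumr big_seq.
under eq_bigr => g /sG Gg do rewrite gr_set_mulr //.
by rewrite -big_seq big_const_seq count_predT iter_addr_0.
Qed.

Lemma gr_seq_mul_set G s :
  {subset s <= G} -> gr_seq s * gr_set G = gr_set G *+ size s.
Proof.
move=> sG; rewrite mulr_suml big_seq.
under eq_bigr => g /sG Gg do rewrite gr_set_mull //.
by rewrite -big_seq big_const_seq count_predT iter_addr_0.
Qed.

Lemma gr_set_sqr G : gr_set G * gr_set G = gr_set G *+ #|G|.
Proof.
rewrite {2}(gr_set_seq (perm_refl _)) gr_set_mul_seq -?cardE // => g.
by rewrite mem_enum.
Qed.

(** Links the indexed form of [signed_sum] with differences of list sums; [phi] is left free so as
    to cover both D and its inverse. *)
Lemma sum_signed_cat (A B : seq gT) (phi : gT -> group_ring gT) k :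
  (size A + size B = k)%N ->
  \sum_(i < k) phi (nth 1%g (A ++ B) i) *~ (if (i < size A)%N then 1 else -1)
  = \sum_(g <- A) phi g - \sum_(g <- B) phi g.
Proof.
move=> <-; rewrite big_split_ord /= -sumrN; congr (_ + _).
  rewrite (big_nth 1%g) big_mkord; apply: eq_bigr => i _.
  by rewrite nth_cat ltn_ord.
rewrite (big_nth 1%g) big_mkord; apply: eq_bigr => i _.
by rewrite nth_cat ltnNge leq_addr /= addKn mulrN1z.
Qed.

(* Here [S] is a partial difference set with parameters (v, m, c, c + 1): as the
   last two differ by 1, the [S]-terms cancel in (1 + 2S)^2. *)
Lemma signed_difference_set_pds G (N S : seq gT) (c : nat) :
  let v := #|G| in let m := size S in
  perm_eq (1%g :: N ++ S) (enum G) ->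
  perm_eq [seq g^-1%g | g <- N] N -> perm_eq [seq g^-1%g | g <- S] S ->
  gr_seq S * gr_seq S = 1 *+ m + gr_seq S *+ c + gr_seq N *+ c.+1 ->
  signed_difference_set G v v.-1 (v%:Z - 2 - 4 * m%:Z + 4 * c.+1%:Z)
    (gr_seq N - gr_seq S).
Proof.
move=> v m perm_G invN invS sqS; split=> //.
have NS_G g : g \in N ++ S -> g \in G.
  by move=> gNS; rewrite -mem_enum -(perm_mem perm_G) inE gNS orbT.
have uniq_NS : uniq (N ++ S).
  by have := enum_uniq G; rewrite -(perm_uniq perm_G) => /andP[].
have sizeNS : (size N + size S)%N = v.-1.
  by rewrite /v cardE -(perm_size perm_G) /= size_cat.
have lt_NS (i : 'I_v.-1) : (i < size (N ++ S))%N by rewrite size_cat sizeNS.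
have sumV A : perm_eq [seq g^-1%g | g <- A] A ->
    \sum_(g <- A) gr_elt g^-1%g = gr_seq A.
  by move=> invA; rewrite /gr_seq -[RHS](perm_big _ invA) big_map.
(* The list has length [v.-1], so the default value of [nth] is never reached. *)
exists (fun i => if (i < size N)%N then 1 else -1), (fun i => nth 1%g (N ++ S) i).
split=> [i|i j /eqP|i||].
- exact/NS_G/mem_nth.
- by rewrite nth_uniq // => /eqP/val_inj.
- by case: ifP; [right | left].
- by rewrite /signed_sum (sum_signed_cat (@gr_elt gT)).
(* Closure of N and S under inversion makes the second factor equal to D. *)
rewrite /signed_sum (sum_signed_cat (fun g => gr_elt g^-1%g)) // !sumV //.
have set_G : gr_set G = 1 + (gr_seq N + gr_seq S).
  by rewrite (gr_set_seq perm_G) /gr_seq big_cons big_cat.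
have eqN : gr_seq N = gr_set G - 1 - gr_seq S.
  by rewrite set_G [1 + _]addrC !addrK.
have subS : {subset S <= G} by move=> g gS; rewrite NS_G // mem_cat gS orbT.
have v_gt0 : (0 < v)%N by apply: cardG_gt0.
rewrite {}eqN in sqS *.
rewrite !(mulrBl, mulrBr) !mul1r !mulr1 sqS gr_set_sqr.
rewrite gr_set_mul_seq // gr_seq_mul_set //.
(* No products remain: both sides are integer combinations of G, 1 and S, so comparing coefficients
   leaves an identity in the integers. *)
apply/ffunP => g; rewrite !(ffunE, gr_mulrnE, gr_mulrzE).
have mulrnz (x : int) n : x *+ n = x * n%:Z by rewrite -mulr_natr natz.
rewrite predn_int // -/v -/m !mulrzz !mulrnz.
ring.
Qed.

End GroupRingSums.

(** * Words modulo p as coordinates of an elementary abelian group *)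

Section Words.
Variable p : nat.

(** The vectors of F_p^n, as lists of naturals so that facts about them can be decided by
    evaluation. *)
Definition words n : seq (seq nat) :=
  iter n (fun W => [seq d :: w | d <- iota 0 p, w <- W]) [:: [::]].

Definition word_add (u w : seq nat) := [seq (x.1 + x.2) %% p | x <- zip u w]%N.

Lemma size_words n : size (words n) = (p ^ n)%N.
Proof. by elim: n => //= n IHn; rewrite size_allpairs size_iota IHn expnS. Qed.

Lemma uniq_words n : uniq (words n).
Proof.
elim: n => //= n IHn; apply: allpairs_uniq; rewrite ?iota_uniq //.
by move=> [a u] [b w] _ _ [-> ->].
Qed.

Lemma words_size n w : w \in words n -> size w = n.
Proof.
elim: n w => [|n IHn] w /=; first by rewrite inE => /eqP->.
by case/allpairsP => -[d u] [_ /IHn uP ->]; rewrite /= uP.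
Qed.

Lemma words_nth n w i : w \in words n -> (i < n -> nth 0 w i < p)%N.
Proof.
elim: n w i => // n IHn w i /=.
case/allpairsP => -[d u] [/= d_lt u_n ->]; case: i => [_|i] /=.
  by move: d_lt; rewrite mem_iota.
exact: IHn.
Qed.

Lemma abelem_words (gT : finGroupType) (G : {group gT}) n :
  prime p -> (p.-abelem G)%g -> #|G| = (p ^ n)%N ->
  exists F : seq nat -> gT,
    {in words n &, {morph F : u w / word_add u w >-> (u * w)%g}} /\
    perm_eq (map F (words n)) (enum G).
Proof.
move=> p_pr abG cardG.
(* Elementary abelian p-groups of equal order are isomorphic. *)
have /isogP[f inj_f im_f] : ([set: 'rV['F_p]_n] \isog G)%g.
  rewrite (isog_abelem_card _ (mxabelem.mx_Fp_abelem 1 n p_pr)) abG cardG eq_sym.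
  by rewrite cardsT card_mx card_Fp // mul1n eqxx.
pose row_of (w : seq nat) : 'rV['F_p]_n := \row_j (nth 0%N w j)%:R.
exists (f \o row_of); split=> [u w uW wW|].
  rewrite /= -morphM ?inE //; congr (f _); apply/rowP => j; rewrite !mxE.
  rewrite (nth_map (0, 0)%N) ?size_zip ?(words_size uW) ?(words_size wW) ?minnn //.
  rewrite nth_zip ?(words_size uW) ?(words_size wW) //= -natrD.
  by apply: val_inj; rewrite /= !val_Fp_nat // modn_mod.
have uniqF : uniq [seq (f \o row_of) w | w <- words n].
  rewrite map_inj_in_uniq ?uniq_words // => u w uW wW /= /(injmP inj_f).
  move=> /(_ (in_setT _) (in_setT _)) /rowP eq_uw.
  apply: (@eq_from_nth _ 0%N) => [|i]; rewrite (words_size uW) ?(words_size wW) //.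
  move=> lt_in; have := congr1 val (eq_uw (Ordinal lt_in)).
  by rewrite !mxE /= !val_Fp_nat // !modn_small ?(words_nth uW) ?(words_nth wW).
have subF : {subset [seq (f \o row_of) w | w <- words n] <= enum G}.
  by move=> _ /mapP[w _ ->]; rewrite mem_enum -im_f mem_morphim ?inE.
apply: uniq_perm; rewrite ?enum_uniq //.
case: (uniq_min_size uniqF subF) => [|_ eq_mem]; last exact: eq_mem.
by rewrite size_map size_words -cardE cardG.
Qed.

End Words.

(** * The Golay configuration in F_3^5 *)

(** The all-ones vector, the unit vectors, and the rotations of the sequence of Legendre symbols
    modulo 5, with 2 standing for -1. *)
Definition golay_columns : seq (seq nat) :=
  nseq 5 1%N :: [seq seq.rot i [:: 1; 0; 0; 0; 0]%N | i <- iota 0 5]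
         ++ [seq seq.rot i [:: 0; 1; 2; 2; 1]%N | i <- iota 0 5].

(** The connection set of the Berlekamp-van Lint-Seidel graph, strongly regular with parameters
    (243, 22, 1, 2). *)
Definition golay_set : seq (seq nat) :=
  golay_columns ++ [seq word_add 3 w w | w <- golay_columns].

Definition golay_rest : seq (seq nat) :=
  [seq w <- words 3 5 | w \notin nseq 5 0%N :: golay_set].

Lemma golay_partition :
  perm_eq (nseq 5 0%N :: golay_rest ++ golay_set) (words 3 5).
Proof. by vm_compute. Qed.

(** Of the 484 ordered pairs, 22 are opposite, the 22 pairs (w, w) give -w, and the other 440 hit
    each of the 220 remaining vectors twice. *)
Lemma golay_sums :
  perm_eq [seq word_add 3 u w | u <- golay_set, w <- golay_set]
          (nseq 22 (nseq 5 0%N) ++ golay_set ++ golay_rest ++ golay_rest).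
Proof. by vm_compute. Qed.

(* In characteristic 3, doubling is negation. *)
Lemma golay_set_double :
  perm_eq [seq word_add 3 w w | w <- golay_set] golay_set.
Proof. by vm_compute. Qed.

Lemma golay_rest_double :
  perm_eq [seq word_add 3 w w | w <- golay_rest] golay_rest.
Proof. by vm_compute. Qed.

(* Transfer to the group *)
Local Close Scope ring_scope.

Theorem corollary3p10 (gT : finGroupType) (G : {group gT}) :
  (3.-abelem G)%g -> #|G| = 243 ->
  exists D : group_ring gT, signed_difference_set G 243 242 161 D.
Proof.
move=> abG cardG.
have [F [FM Fall]] := abelem_words (n := 5) (isT : prime 3) abG cardG.
set z := nseq 5 0%N; pose S := map F golay_set; pose N := map F golay_rest.
have in_words w : w \in z :: golay_rest ++ golay_set -> w \in words 3 5.
  by rewrite (perm_mem golay_partition).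
have set_words : {subset golay_set <= words 3 5}.
  by move=> w wS; apply: in_words; rewrite inE mem_cat wS !orbT.
have rest_words : {subset golay_rest <= words 3 5}.
  by move=> w; rewrite mem_filter => /andP[].
have FG w : w \in words 3 5 -> F w \in G.
  by move=> wW; rewrite -mem_enum -(perm_mem Fall) map_f.
have z_word : z \in words 3 5 by apply: in_words; rewrite mem_head.
(* As z + z evaluates to z, its image is idempotent. *)
have Fz : F z = 1%g by apply: (mulgI (F z)); rewrite -FM // mulg1.
have FV w : w \in words 3 5 -> F (word_add 3 w w) = (F w)^-1%g.
  move=> wW; rewrite FM //; apply/eqP; rewrite eq_sym eq_invg_mul.
  have [_ cubeG] := abelemP (isT : prime 3) abG.
  by rewrite -expg2 -expgS cubeG ?FG.
have perm_G : perm_eq (1%g :: N ++ S) (enum G).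
  by rewrite -Fz -map_cat -map_cons -(permPr Fall) perm_map ?golay_partition.
have invF W : {subset W <= words 3 5} ->
    perm_eq [seq word_add 3 w w | w <- W] W ->
    perm_eq [seq g^-1%g | g <- map F W] (map F W).
  move=> sW dW.
  have -> : [seq g^-1%g | g <- map F W] = map F [seq word_add 3 w w | w <- W].
    by rewrite -!map_comp; apply/eq_in_map => w /sW/FV/= ->.
  exact: perm_map.
have sizeS : size S = 22 by rewrite size_map.
have sqS : (gr_seq S * gr_seq S
            = 1 *+ size S + gr_seq S *+ 1 + gr_seq N *+ 2)%R.
  rewrite /gr_seq mulr_suml big_map.
  under eq_bigr => u _ do rewrite mulr_sumr big_map.
  (* Additivity of [F] reduces the square of S to the list of pairwise sums of words. *)
  transitivity (\sum_(w <- [seq word_add 3 u w | u <- golay_set, w <- golay_set])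
                  gr_elt (F w))%R.
    rewrite big_allpairs_dep /= big_seq [RHS]big_seq.
    apply: eq_bigr => u /set_words uW; rewrite big_seq [RHS]big_seq.
    by apply: eq_bigr => w /set_words wW; rewrite gr_eltM FM.
  rewrite (perm_big _ golay_sums) !big_map !big_cat big_nseq Fz iter_addr_0.
  by rewrite sizeS mulr1n mulr2n; apply: addrA.
exists (gr_seq N - gr_seq S)%R.
have := signed_difference_set_pds perm_G (invF _ rest_words golay_rest_double)
  (invF _ set_words golay_set_double) sqS.
(* Here c = 1, and 243 - 2 - 4 * 22 + 4 * 2 = 161. *)
by rewrite sizeS cardG.
Qed.
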